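(* Let $p$ be an odd prime and let $b,c\in\mathbb{Z}$. For $n\in\mathbb{N}$ put $$T_n(b,c)=\sum_{k=0}^{\lfloor n/2\rfloor}\binom{n}{2k}\binom{2k}{k}b^{n-2k}c^k,\qquad M_n(b,c)=\sum_{k=0}^{\lfloor n/2\rfloor}\binom{n}{2k}\frac{1}{k+1}\binom{2k}{k}b^{n-2k}c^k.$$ (i) For any integer $m\not\equiv 0\pmod p$, $$\sum_{k=0}^{p-1}\frac{T_k(b,c)}{m^k}\equiv\left(\frac{(m-b)^2-4c}{p}\right)\pmod p$$ and $$2c\sum_{k=0}^{p-1}\frac{M_k(b,c)}{m^k}\equiv(m-b)^2-((m-b)^2-4c)\left(\frac{(m-b)^2-4c}{p}\right)\pmod p.$$ (ii) If $p$ does not divide $d=b^2-4c$, then $$\sum_{k=0}^{p-1}\frac{T_k(b,c)^2}{d^k}\equiv\left(\frac{cd}{p}\right)\pmod p.$$ If $b\not\equiv 2c\pmod p$, then $$\sum_{k=0}^{p-1}\frac{T_k(b,c^2)^2}{(b-2c)^{2k}}\equiv\left(\frac{-c^2}{p}\right)\pmod p.$$ (iii) Assume $p\nmid c$. If $d=b^2-4c\not\equiv0\pmod p$, then $$\sum_{k=0}^{p-1}\frac{T_k(b,c)M_k(b,c)}{d^k}\equiv 0\pmod p.$$ If $D=b^2-4c^2\not\equiv 0\pmod p$, then $$\sum_{k=0}^{p-1}\frac{T_k(b,c^2)M_k(b,c^2)}{(b-2c)^{2k}}\equiv\frac{4b}{b+2c}\left(\frac{D}{p}\right)\pmod p.$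$
   Context: $T_n(b,c)$ equals the coefficient of $x^n$ in $(x^2+bx+c)^n$ (generalized central trinomial coefficient), and $M_n(b,c)$ is the generalized Motzkin number (with $C_k=\frac1{k+1}\binom{2k}k$ the Catalan numbers). $\left(\frac{\cdot}{p}\right)$ denotes the Legendre symbol. Congruences between rational numbers whose denominators are prime to $p$ are understood in the ring of rationals with denominator prime to $p$. *)

(* Defs.v *)
From mathcomp Require Import all_boot all_order all_algebra.

Set Implicit Arguments.
Unset Strict Implicit.
Unset Printing Implicit Defensive.

Import Order.TTheory GRing.Theory Num.Theory.
Local Open Scope ring_scope.

Definition trinomial_coef (n : nat) (b c : int) : int :=
  \sum_(k < n./2.+1)
    'C(n, k.*2)%:R * 'C(k.*2, k)%:R * b ^+ (n - k.*2) * c ^+ k.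

(* Taken in rat so that 1 / (k + 1) is a genuine division. *)
Definition motzkin_num (n : nat) (b c : int) : rat :=
  \sum_(k < n./2.+1)
    'C(n, k.*2)%:R * (k.+1%:R^-1 * 'C(k.*2, k)%:R)
      * b%:~R ^+ (n - k.*2) * c%:~R ^+ k.

Definition legendre (p : nat) (a : int) : int :=
  if (p %| a)%Z then 0
  else if [exists x : 'I_p, ((x : nat)%:Z ^+ 2 == a %[mod p])%Z] then 1
  else -1.

(* The ring of rationals with denominator prime to p; denq x is the positive
   denominator of x in lowest terms. *)
Definition pintegral (p : nat) (x : rat) : Prop := coprimez p (denq x).

Definition rat_congr (p : nat) (x y : rat) : Prop :=
  [/\ pintegral p x, pintegral p y
    & exists2 z : rat, pintegral p z & x - y = p%:R * z].

Notation "x '≡' y '%[ratmod' p ]" := (rat_congr p x y)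
  (at level 70, y at next level, format "x  '≡'  y  '%[ratmod'  p ]")
  : ring_scope.

(* Main.v *)
Require Import Defs.
From mathcomp Require Import all_boot all_order all_algebra.
From mathcomp Require Import all_field ring zify.

(* Both T_n and M_n are binomial transforms sum_i 'C(n, i) x ^+ (n - i) a_i, and
   in characteristic [p] the geometric sum of the powers of X + x is
   (X + x - m) ^+ (p - 1).  Hence the sums in (i) are T_(p-1)(b - m, c) and
   M_(p-1)(b - m, c), which follow from 'C(2k, k) = 'C((p-1)/2, k) (-4)^k and
   Euler's criterion.

   For (ii) and (iii), x^2 + b x + e^2 = (x + e)^2 + (b - 2 e) x shows that
   T_n(b, e^2) and M_n(b, e^2) are (b - 2 e)^n times the binomial transforms (at
   1) of 'C(2i, i) u^i and Cat_(i+1) u^i, where u = e / (b - 2 e).  Products of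
   two such transforms are summed with the help of
   sum_(k < p) 'C(k, i) 'C(k, j), which vanishes modulo [p] for i + j < p - 1;
   as 'C(2i, i) vanishes for (p-1)/2 < i < p, hardly any term survives.  Using
   the same root [e] twice yields the denominator (b - 2 e)^2, using [e] and
   [- e] yields b^2 - 4 e^2; in the latter case [e] may have to be taken in an
   extension of the prime field. *)

Set Implicit Arguments.
Unset Strict Implicit.
Unset Printing Implicit Defensive.

Import Order.TTheory GRing.Theory Num.Theory.
Local Open Scope ring_scope.

(** * Catalan, trinomial and Motzkin numbers *)

(** A difference rather than a quotient by k + 1: it stays in [nat], maps to every ring, and can be
    evaluated modulo [p] even when [p] divides k + 1. *)
Definition catalan (k : nat) : nat := ('C(k.*2, k) - 'C(k.*2, k.+1))%N.

Lemma leq_bin_center k : ('C(k.*2, k.+1) <= 'C(k.*2, k))%N.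
Proof.
have := mul_bin_left k.*2 k; rewrite -addnn addnK => E.
rewrite -(leq_pmul2l (ltn0Sn k)) E.
by rewrite leq_mul2r leqnSn orbT.
Qed.

Lemma mulS_catalan k : (k.+1 * catalan k = 'C(k.*2, k))%N.
Proof.
rewrite /catalan mulnBr mul_bin_left -addnn addnK -mulnBl subSnn.
by rewrite mul1n.
Qed.

Lemma binSS N m : ('C(N.+2, m.+2) = 'C(N, m.+2) + 'C(N, m.+1).*2 + 'C(N, m))%N.
Proof. by rewrite !binS; lia. Qed.

Lemma bin_centerS k :
  ('C(k.+1.*2, k.+1) = 'C(k.*2, k.+1).*2 + 'C(k.*2, k).*2)%N.
Proof.
case: k => [|k] //; rewrite doubleS binSS.
have <- : 'C(k.+1.*2, k) = 'C(k.+1.*2, k.+2).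
  by rewrite -[RHS]bin_sub; [congr ('C(_, _)); lia | lia].
by lia.
Qed.

(** Expresses a Catalan number through two consecutive central binomial coefficients, so that the
    sum in [motzkin_predp] can be compared with its own shift. *)
Lemma double_catalan k : ((catalan k).*2 + 'C(k.+1.*2, k.+1) = 4 * 'C(k.*2, k))%N.
Proof. by have := leq_bin_center k; rewrite bin_centerS /catalan; lia. Qed.

(** The two binomials are the coefficients of X^k and X^(k+2) in (X + 1)^(2k), the pair that appears
    in [motzkin_shift]. *)
Lemma catalanS k : (catalan k.+1 + 'C(k.*2, k.+2) = 'C(k.*2, k))%N.
Proof.
have := leq_bin_center k.+1; rewrite /catalan bin_centerS doubleS binSS.
by lia.
Qed.

Lemma sum_even_ord (R : nmodType) (F : nat -> R) n :
  (forall i, odd i -> F i = 0) ->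
  \sum_(i < n.+1) F i = \sum_(j < n./2.+1) F j.*2.
Proof.
move=> F0; suff: \sum_(i < n.+1) F i = \sum_(j < n./2.+1) F j.*2
           /\ \sum_(i < n.+2) F i = \sum_(j < n.+1./2.+1) F j.*2 by case.
elim: n => [|n [IH1 IH2]].
  by rewrite !big_ord_recl !big_ord0 /= (F0 1%N) // !addr0.
split=> //; rewrite big_ord_recr IH2 /= uphalfE /=.
have [on|en] := boolP (odd n).
  by rewrite F0 /= ?on // addr0 !uphalf_half on.
rewrite !uphalf_half (negPf en) add0n [RHS]big_ord_recr /=.
by congr (_ + F _); move: en; lia.
Qed.

Definition binom_transform (R : comNzRingType) (a : nat -> R) (x : R) (n : nat) :=
  \sum_(i < n.+1) 'C(n, i)%:R * x ^+ (n - i) * a i.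

Lemma binom_transform_even (R : comNzRingType) (a : nat -> R) x n :
  (forall i, odd i -> a i = 0) ->
  binom_transform a x n =
  \sum_(k < n./2.+1) 'C(n, k.*2)%:R * x ^+ (n - k.*2) * a k.*2.
Proof.
move=> a0; pose F i := 'C(n, i)%:R * x ^+ (n - i) * a i.
by apply: (sum_even_ord (F := F)) => i /a0; rewrite /F => ->; rewrite mulr0.
Qed.

(** In the binomial expansion the factor ['X^(n - i)] lowers the index [n + s] to [i + s]. The shift
    [s = 2] serves the Motzkin numbers. *)
Lemma coef_trinomial (R : comNzRingType) (q : {poly R}) x n s :
  ((q + x *: 'X) ^+ n)`_(n + s) =
  binom_transform (fun i => (q ^+ i)`_(i + s)) x n.
Proof.
rewrite addrC exprDn coef_sum; apply: eq_bigr => i _ /=.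
have lin : (i <= n)%N by rewrite -ltnS.
rewrite coefMn exprZn -scalerAl coefZ coefXnM ifN; last by lia.
rewrite -mulrA mulr_natl; congr (_ * _`_ _ *+ _); lia.
Qed.

Lemma coef_trinomial0 (R : comNzRingType) (q : {poly R}) x n :
  ((q + x *: 'X) ^+ n)`_n = binom_transform (fun i => (q ^+ i)`_i) x n.
Proof.
rewrite -[X in _`_X]addn0 coef_trinomial.
by apply: eq_bigr => i _; rewrite addn0.
Qed.

Lemma coefXDCn (R : comNzRingType) (e : R) n i :
  (('X + e%:P) ^+ n)`_i = 'C(n, i)%:R * e ^+ (n - i).
Proof.
rewrite mulr_natl addrC exprDn coef_sum.
have [lin|ltni] := ltnP i n.+1.
  rewrite (bigD1 (Ordinal lin)) //= big1 ?addr0.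
    by rewrite coefMn -polyC_exp coefCM coefXn eqxx mulr1.
  move=> j nj; rewrite coefMn -polyC_exp coefCM coefXn.
  by rewrite -val_eqE /= eq_sym in nj; rewrite (negPf nj) mulr0 mul0rn.
rewrite bin_small // big1 // => j _; rewrite coefMn -polyC_exp coefCM coefXn.
have := ltn_ord j; rewrite ltnS => lj.
by rewrite gtn_eqF ?mulr0 ?mul0rn // (leq_ltn_trans lj).
Qed.

Lemma coefX2DCn (R : comNzRingType) (c : R) n i :
  (('X^2 + c%:P) ^+ n)`_i = if odd i then 0 else 'C(n, i./2)%:R * c ^+ (n - i./2).
Proof.
have -> : 'X^2 + c%:P = ('X + c%:P) \Po 'X^2 by rewrite comp_polyD comp_polyX comp_polyC.
rewrite -rmorphXn /= coef_comp_poly_Xn // dvdn2 divn2 coefXDCn.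
by case: odd.
Qed.

(** Stated over any ring, like [motzkin] below, so that the numbers can be mapped to ['F_p] and to
    its extensions. *)
Definition trinomial (R : comNzRingType) (n : nat) (b c : R) : R :=
  \sum_(k < n./2.+1) 'C(n, k.*2)%:R * 'C(k.*2, k)%:R * b ^+ (n - k.*2) * c ^+ k.

Definition motzkin (R : comNzRingType) (n : nat) (b c : R) : R :=
  \sum_(k < n./2.+1) 'C(n, k.*2)%:R * (catalan k)%:R * b ^+ (n - k.*2) * c ^+ k.

Lemma trinomial_binom (R : comNzRingType) n (b c : R) :
  trinomial n b c = binom_transform (fun i => (('X^2 + c%:P) ^+ i)`_i) b n.
Proof.
rewrite binom_transform_even => [|i oi].
  apply: eq_bigr => k _; rewrite coefX2DCn odd_double doubleK.
  by rewrite -addnn addnK; ring.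
by rewrite coefX2DCn oi.
Qed.

Lemma motzkin_binom (R : comNzRingType) n (b c : R) :
  motzkin n b c = binom_transform
    (fun i => (('X^2 + c%:P) ^+ i)`_i - c * (('X^2 + c%:P) ^+ i)`_(i + 2)) b n.
Proof.
rewrite binom_transform_even => [|i oi].
  apply: eq_bigr => k _; rewrite !coefX2DCn oddD odd_double addn2 /= doubleK.
  rewrite /catalan natrB ?leq_bin_center //.
  have -> : (k.*2 - k = k)%N by lia.
  (* For [k = 0] the exponent [k.*2 - k.+1] is truncated to 0, but the binomial in front of it
     vanishes. *)
  case: (val k) => [|j]; first by rewrite double0 (@bin_small 0 1) //; ring.
  have -> : (j.+1.*2 - j.+2 = j)%N by lia.
  by rewrite exprS; ring.
by rewrite !coefX2DCn oddD oi /= mulr0 subr0.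
Qed.

Lemma trinomial_shift (R : comNzRingType) n (b e : R) :
  trinomial n b (e ^+ 2) =
  binom_transform (fun i => 'C(i.*2, i)%:R * e ^+ i) (b - 2 * e) n.
Proof.
rewrite trinomial_binom -coef_trinomial0.
have -> : 'X^2 + (e ^+ 2)%:P + b *: 'X = ('X + e%:P) ^+ 2 + (b - 2 * e) *: 'X.
  by rewrite -!mul_polyC; ring.
rewrite coef_trinomial0; apply: eq_bigr => i _ /=.
rewrite -exprM mul2n coefXDCn; congr (_ * (_ * _ ^+ _)); lia.
Qed.

(* Subtracting [c] times the coefficient two places higher turns the central
   coefficients 'C(2k, k) into Catalan numbers, before and after the shift. *)
Lemma motzkin_shift (R : comNzRingType) n (b e : R) :
  motzkin n b (e ^+ 2) =
  binom_transform (fun i => (catalan i.+1)%:R * e ^+ i) (b - 2 * e) n.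
Proof.
(* Linearity, used forwards to reach coefficients of powers of the trinomial and backwards once it
   is rewritten through [r]. *)
have binomB (a a' : nat -> R) y z : binom_transform (fun i => a i - y * a' i) z n
    = binom_transform a z n - y * binom_transform a' z n.
  rewrite /binom_transform mulr_sumr -sumrB.
  by apply: eq_bigr => i _; rewrite mulrBr mulrCA.
pose q : {poly R} := 'X^2 + (e ^+ 2)%:P; pose r : {poly R} := ('X + e%:P) ^+ 2.
rewrite motzkin_binom (binomB (fun i => (q ^+ i)`_i) (fun i => (q ^+ i)`_(i + 2))).
rewrite -coef_trinomial0 -coef_trinomial.
have -> : q + b *: 'X = r + (b - 2 * e) *: 'X.
  by rewrite /q /r -!mul_polyC; ring.
rewrite coef_trinomial0 coef_trinomial.
rewrite -(binomB (fun i => (r ^+ i)`_i) (fun i => (r ^+ i)`_(i + 2))).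
apply: eq_bigr => i _ /=; rewrite /r -exprM mul2n !coefXDCn; congr (_ * _).
rewrite -(catalanS i) natrD addn2.
have -> : (i.*2 - i = i)%N by lia.
(* For [i < 2] the exponent [i.*2 - (i + 2)] is truncated, and ['C(i.*2, i.+2)] vanishes. *)
case: (val i) => [|[|j]].
- by rewrite double0 (@bin_small 0 2) //; ring.
- by rewrite (@bin_small 1.*2 3) //; ring.
have -> : (j.+2.*2 - j.+4 = j)%N by lia.
by rewrite -[j.+2]addn2 exprD; ring.
Qed.

(** * Binomial sums and coefficients in characteristic p *)

(** After multiplication by [x - y] both sides are [x ^+ p - y ^+ p], by Frobenius. *)
Lemma geometric_sum_pchar (R : idomainType) (p : nat) (x y : R) :
  p \in [pchar R] -> x != y ->
  \sum_(k < p) x ^+ k * y ^+ (p.-1 - k) = (x - y) ^+ p.-1.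
Proof.
move=> pcharR; rewrite -subr_eq0 => xy0; apply: (mulfI xy0).
rewrite -exprS prednK ?prime_gt0 ?(pcharf_prime pcharR) //.
rewrite -(pFrobenius_autE pcharR) pFrobenius_autB_comm; last exact: mulrC.
rewrite !pFrobenius_autE.
rewrite -[RHS]opprB subrXX -mulNr opprB; congr (_ * _).
by apply: eq_bigr => k _; rewrite mulrC.
Qed.

(** Coefficient of X^i in [geometric_sum_pchar], taken over [{poly R}] at ['X + x%:P] and [z%:P]. *)
Lemma sum_bin_geometric_pchar (R : idomainType) (p i : nat) (x z : R) :
  p \in [pchar R] ->
  \sum_(k < p) 'C(k, i)%:R * x ^+ (k - i) * z ^+ (p.-1 - k) =
  'C(p.-1, i)%:R * (x - z) ^+ (p.-1 - i).
Proof.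
move=> pcharR; have nXx : 'X + x%:P != z%:P.
  rewrite -subr_eq0 -addrA -polyCB -size_poly_eq0.
  by rewrite -[_%:P]opprK -polyCN size_XsubC.
have pcharP : p \in [pchar {poly R}] by rewrite pchar_poly.
have /(congr1 (fun q : {poly R} => q`_i)) := geometric_sum_pchar pcharP nXx.
rewrite -addrA -polyCB coefXDCn coef_sum => <-.
by apply: eq_bigr => k _; rewrite -polyC_exp coefMC coefXDCn.
Qed.

Lemma binom_transform_widen (R : comNzRingType) (p k : nat) (a : nat -> R) x :
  (k < p)%N ->
  binom_transform a x k = \sum_(i < p) 'C(k, i)%:R * x ^+ (k - i) * a i.
Proof.
move=> kp; pose f i := 'C(k, i)%:R * x ^+ (k - i) * a i.
rewrite /binom_transform (big_ord_widen p f kp) big_mkcond.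
apply: eq_bigr => i _; rewrite /f; case: ltnP => // ki.
by rewrite bin_small // !mul0r.
Qed.

Lemma sum_binom_transform_pchar (R : idomainType) (p : nat) (a : nat -> R) x z :
  p \in [pchar R] ->
  \sum_(k < p) binom_transform a x k * z ^+ (p.-1 - k) =
  binom_transform a (x - z) p.-1.
Proof.
move=> pcharR; have p0 : (0 < p)%N by rewrite prime_gt0 ?(pcharf_prime pcharR).
under eq_bigr => k _ do rewrite (binom_transform_widen _ _ (ltn_ord k)) mulr_suml.
rewrite exchange_big /= /binom_transform prednK //.
apply: eq_bigr => i _; rewrite -sum_bin_geometric_pchar // mulr_suml.
by apply: eq_bigr => k _; rewrite mulrAC.
Qed.

(** By Pascal's rule consecutive entries of row p - 1 add up to an entry of row [p], which
    vanishes. *)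
Lemma bin_predp_pchar (R : idomainType) (p i : nat) :
  p \in [pchar R] -> (i < p)%N -> 'C(p.-1, i)%:R = (-1) ^+ i :> R.
Proof.
move=> pcharR; elim: i => [|i IHi] ip; first by rewrite bin0.
have /eqP := bin_lt_pcharf_0 pcharR (ip : (0 < i.+1 < p)%N).
rewrite -{1}(ltn_predK ip) binS natrD IHi; last exact: ltnW.
by rewrite addr_eq0 exprS mulN1r => /eqP.
Qed.

Lemma bin_subp2_pchar (R : idomainType) (p i : nat) :
  p \in [pchar R] -> (i < p.-1)%N -> 'C(p.-2, i)%:R = (-1) ^+ i * i.+1%:R :> R.
Proof.
move=> pcharR; elim: i => [|i IHi] ip; first by rewrite bin0 mulr1.
have i1p : (i.+1 < p)%N by apply: leq_trans ip (leq_pred p).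
have := bin_predp_pchar pcharR i1p.
rewrite -{1}(ltn_predK ip) binS natrD IHi; last exact: ltnW.
move=> /eqP; rewrite eq_sym -subr_eq => /eqP <-.
by rewrite -[i.+2]addn1 natrD exprS; ring.
Qed.

Lemma natr_half_pchar (R : nzRingType) (p : nat) :
  p \in [pchar R] -> odd p -> 2 * p./2%:R = -1 :> R.
Proof.
move=> pcharR op; apply/eqP; rewrite -subr_eq0 opprK -natrM natr1 mul2n.
have -> : p./2.*2.+1 = p by rewrite -[RHS]odd_double_half op.
by rewrite (pcharf0 pcharR).
Qed.

(** Both sides satisfy the same recurrence: with h = [p./2] and 2h = -1, the factor 2(2k + 1) on the
    left is the factor -4(h - k) on the right. *)
Lemma bin_center_pchar (F : fieldType) (p k : nat) :
  p \in [pchar F] -> odd p -> (k < p)%N ->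
  'C(k.*2, k)%:R = 'C(p./2, k)%:R * (- 4) ^+ k :> F.
Proof.
move=> pcharF op; elim: k => [|k IHk] kp; first by rewrite !bin0 mul1r.
have k0 : k.+1%:R != 0 :> F.
  by rewrite -(dvdn_pcharf pcharF) gtnNdvd.
apply: (mulfI k0).
have -> : k.+1%:R * 'C(k.+1.*2, k.+1)%:R = 2 * (k.*2.+1)%:R * 'C(k.*2, k)%:R :> F.
  rewrite -!natrM; congr _%:R.
  rewrite -mul_bin_diag -mulnA (mul_bin_down k.*2.+1 k).
  have -> : (k.*2.+1 - k = k.+1)%N by lia.
  by rewrite mulnA mul2n.
rewrite IHk; last exact: ltnW.
rewrite [RHS]mulrA -[in RHS]natrM mul_bin_left [in RHS]natrM exprS.
have [lkn|] := leqP k p./2; last by move=> ?; rewrite bin_small // !(mulr0, mul0r).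
rewrite natrB // -(natr1 k.*2) -mul2n natrM.
have := natr_half_pchar pcharF op; set h := (p./2)%:R => hE.
have -> : 2 * (2 * k%:R + 1) = (2 * h - 2 * k%:R) * (-2) :> F by rewrite hE; ring.
ring.
Qed.

Lemma bin_center_pchar0 (F : fieldType) (p k : nat) :
  p \in [pchar F] -> odd p -> (p./2 < k < p)%N -> 'C(k.*2, k)%:R = 0 :> F.
Proof.
move=> pcharF op /andP[pk kp].
by rewrite (bin_center_pchar pcharF op kp) bin_small // mul0r.
Qed.

(** The bound [k.+2 < p] keeps [k.+2] invertible; the indices p - 1 and [p] are evaluated separately
    below. *)
Lemma catalan_pchar0 (F : fieldType) (p k : nat) :
  p \in [pchar F] -> odd p -> (p./2 <= k)%N -> (k.+2 < p)%N ->
  (catalan k.+1)%:R = 0 :> F.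
Proof.
move=> pcharF op pk kp.
have k0 : k.+2%:R != 0 :> F by rewrite -(dvdn_pcharf pcharF) gtnNdvd.
apply: (mulfI k0); rewrite -natrM mulS_catalan mulr0.
by rewrite (bin_center_pchar0 pcharF op) // ltnS pk ltnW.
Qed.

(** In Vandermonde's sum only the two end terms of row [p] survive. *)
Lemma bin_addp_pchar (R : nzRingType) (p l : nat) :
  p \in [pchar R] -> 'C(p + l, p)%:R = 1 + 'C(l, p)%:R :> R.
Proof.
move=> pcharR; have p0 : (0 < p)%N by rewrite prime_gt0 ?(pcharf_prime pcharR).
rewrite -binomial.Vandermonde natr_sum big_ord_recr /= binn subnn bin0 muln1.
rewrite [LHS]addrC; congr (_ + _).
rewrite (bigD1 (Ordinal p0)) //= bin0 mul1n subn0 big1 ?addr0 // => i i0.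
rewrite natrM (bin_lt_pcharf_0 pcharR) ?mul0r // ltn_ord andbT lt0n.
by rewrite -val_eqE in i0.
Qed.

Lemma catalan_p_pchar (F : fieldType) (p : nat) :
  p \in [pchar F] -> (catalan p)%:R = 2 :> F.
Proof.
move=> pcharF; have := congr1 (fun n => n%:R : F) (mulS_catalan p).
rewrite /= natrM -natr1 (pcharf0 pcharF) add0r mul1r => ->.
by rewrite -addnn bin_addp_pchar // binn.
Qed.

Lemma catalan_predp_pchar (F : fieldType) (p : nat) :
  p \in [pchar F] -> odd p -> (catalan p.-1)%:R = -1 :> F.
Proof.
move=> pcharF op; have p1 := prime_gt1 (pcharf_prime pcharF).
rewrite /catalan natrB ?leq_bin_center // (bin_center_pchar0 pcharF op); last lia.
have -> : (p.-1.*2 = p + p.-2)%N by lia.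
rewrite (ltn_predK p1) bin_addp_pchar // bin_small; last lia.
by rewrite sub0r addr0.
Qed.

(** Compare coefficients of X^i in: the sum over k of 'C(k, j) (X + 1)^k is 'C(p-1, j) X^(p-1-j) (X
    + 1)^j. *)
Lemma sum_bin_bin_pchar (F : fieldType) (p i j : nat) :
  p \in [pchar F] -> (i + j <= p.-1)%N ->
  \sum_(k < p) 'C(k, i)%:R * 'C(k, j)%:R =
  if (i + j == p.-1)%N then 'C(p.-1, j)%:R else 0 :> F.
Proof.
move=> pcharF ijp.
have pcharP : p \in [pchar {poly F}] by rewrite pchar_poly.
pose x : {poly F} := 'X + 1%:P.
have := sum_bin_geometric_pchar j x 1 pcharP.
move=> /(congr1 (fun q : {poly F} => (q * x ^+ j)`_i)).
rewrite {3}/x addrK -mulrA -polyC_natr coefCM ['X^_ * _]mulrC coefMXn.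
rewrite mulr_suml coef_sum => E.
transitivity ('C(p.-1, j)%:R *
    (if (i < p.-1 - j)%N then 0 else (x ^+ j)`_(i - (p.-1 - j)))).
  rewrite -E; apply: eq_bigr => k _; rewrite expr1n mulr1.
  have [jk|kj] := leqP j k; last by rewrite (bin_small kj) !(mulr0, mul0r) coef0.
  rewrite -mulrA -exprD subnK // -polyC_natr coefCM coefXDCn expr1n mulr1.
  by rewrite mulrC.
case: eqP => ij; last by rewrite ifT ?mulr0 //; lia.
rewrite ifF; last by lia.
have -> : (i - (p.-1 - j) = 0)%N by lia.
by rewrite coefXDCn expr1n bin0 !mulr1.
Qed.

(** * Sums of products of binomial transforms *)

Lemma sum_binom_transform_mul (R : comNzRingType) (p : nat) (a b : nat -> R) :
  \sum_(k < p) binom_transform a 1 k * binom_transform b 1 k =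
  \sum_(i < p) \sum_(j < p) a i * b j * \sum_(k < p) 'C(k, i)%:R * 'C(k, j)%:R.
Proof.
under eq_bigr => k _ do rewrite !(binom_transform_widen _ _ (ltn_ord k)) mulr_suml.
rewrite exchange_big; apply: eq_bigr => i _ /=.
under eq_bigr do rewrite mulr_sumr.
rewrite exchange_big; apply: eq_bigr => j _ /=.
by rewrite mulr_sumr; apply: eq_bigr => k _; rewrite !expr1n; ring.
Qed.

Lemma binom_transform_scale (F : fieldType) (a : nat -> F) (e y : F) n : y != 0 ->
  binom_transform (fun i => a i * e ^+ i) y n =
  y ^+ n * binom_transform (fun i => a i * (e / y) ^+ i) 1 n.
Proof.
move=> y0; rewrite /binom_transform mulr_sumr; apply: eq_bigr => i _.
have -> : y ^+ n = y ^+ (n - i) * y ^+ i by rewrite -exprD subnK // -ltnS.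
by rewrite expr1n expr_div_n; field; rewrite expf_neq0.
Qed.

(** By [trinomial_shift] this is T_n(1 + 2u, u^2); likewise [catalan_sum] is M_n(1 + 2u, u^2) by
    [motzkin_shift]. *)
Definition central_sum (F : fieldType) (u : F) :=
  binom_transform (fun i => 'C(i.*2, i)%:R * u ^+ i) 1.

Definition catalan_sum (F : fieldType) (u : F) :=
  binom_transform (fun i => (catalan i.+1)%:R * u ^+ i) 1.

Lemma trinomial_central_sum (F : fieldType) n (b e : F) : b - 2 * e != 0 ->
  trinomial n b (e ^+ 2) = (b - 2 * e) ^+ n * central_sum (e / (b - 2 * e)) n.
Proof. by move=> y0; rewrite trinomial_shift binom_transform_scale. Qed.

Lemma motzkin_catalan_sum (F : fieldType) n (b e : F) : b - 2 * e != 0 ->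
  motzkin n b (e ^+ 2) = (b - 2 * e) ^+ n * catalan_sum (e / (b - 2 * e)) n.
Proof.
move=> y0; rewrite motzkin_shift.
exact: (binom_transform_scale (fun i => (catalan i.+1)%:R)).
Qed.

(* Only [i = j = p./2] survives: 'C(2i, i) vanishes for [i > p./2] and
   sum_bin_bin_pchar vanishes for [i + j < p - 1]. *)
Lemma sum_central_central (F : fieldType) (p : nat) (u v : F) :
  p \in [pchar F] -> odd p ->
  \sum_(k < p) central_sum u k * central_sum v k = (- (u * v)) ^+ p./2.
Proof.
move=> pcharF op; have p1 := prime_gt1 (pcharf_prime pcharF).
have hp : (p./2 < p)%N by lia.
have pE : p.-1 = p./2.*2 by lia.
rewrite sum_binom_transform_mul (bigD1 (Ordinal hp)) //= [X in _ + X = _]big1 ?addr0.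
  rewrite (bigD1 (Ordinal hp)) //= [X in _ + X = _]big1 ?addr0.
    rewrite sum_bin_bin_pchar //; last by lia.
    rewrite ifT; last by lia.
    rewrite -pE bin_predp_pchar // [(- (u * v)) ^+ _]exprNn exprMn.
    (* All three binomial coefficients in the surviving term equal [s], and their product is [s]
       again. *)
    set s := (-1) ^+ _; have ss : s * s = 1 by rewrite -exprMn mulrNN mulr1 expr1n.
    transitivity (s * s * (s * (u ^+ p./2 * v ^+ p./2))); first by ring.
    by rewrite ss mul1r.
  move=> j; rewrite -val_eqE /= => nj; have [hj|jh] := ltnP p./2 j.
    by rewrite (bin_center_pchar0 (k := j) pcharF op) ?hj ?ltn_ord // mul0r mulr0 mul0r.
  rewrite sum_bin_bin_pchar //; last by lia.
  by rewrite ifF ?mulr0 //; lia.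
move=> i; rewrite -val_eqE /= => ni; apply: big1 => j _.
have [hi|ih] := ltnP p./2 i.
  by rewrite (bin_center_pchar0 (k := i) pcharF op) ?hi ?ltn_ord // !mul0r.
have [hj|jh] := ltnP p./2 j.
  by rewrite (bin_center_pchar0 (k := j) pcharF op) ?hj ?ltn_ord // mul0r mulr0 mul0r.
rewrite sum_bin_bin_pchar //; last by lia.
by rewrite ifF ?mulr0 //; lia.
Qed.

(** By [bin_center_pchar] this is the binomial expansion of the right-hand side. *)
Lemma sum_sign_bin_center (F : fieldType) (p : nat) (u : F) :
  p \in [pchar F] -> odd p ->
  \sum_(i < p) (-1) ^+ i * ('C(i.*2, i)%:R * u ^+ i) = (1 + 4 * u) ^+ p./2.
Proof.
move=> pcharF op; have hp : (p./2 < p)%N by lia.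
pose f i := 1 ^+ (p./2 - i) * (4 * u) ^+ i *+ 'C(p./2, i).
rewrite exprDn (big_ord_widen p f hp).
rewrite [RHS]big_mkcond; apply: eq_bigr => i _; rewrite /f.
rewrite (bin_center_pchar pcharF op) //; case: ltnP => hi; last first.
  by rewrite bin_small // !mul0r mulr0.
have -> : (4 * u) ^+ i = (-1) ^+ i * (-4) ^+ i * u ^+ i.
  by rewrite -!exprMn; congr (_ ^+ _); ring.
by rewrite expr1n mul1r -mulr_natl; ring.
Qed.

(** The weight [i] amounts to applying u d/du to the previous identity; the factor 4h with h =
    [p./2] becomes -2. *)
Lemma sum_sign_mul_bin_center (F : fieldType) (p : nat) (u : F) :
  p \in [pchar F] -> odd p ->
  \sum_(i < p) (-1) ^+ i * i%:R * ('C(i.*2, i)%:R * u ^+ i) =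
  - (2 * u * (1 + 4 * u) ^+ p./2.-1).
Proof.
move=> pcharF op; have p1 := prime_gt1 (pcharf_prime pcharF).
have hp : (p./2.-1.+1 < p)%N by lia.
have p0 : (0 < p)%N by lia.
have h2 := natr_half_pchar pcharF op.
transitivity (p./2%:R * 4 * u * (1 + 4 * u) ^+ p./2.-1); last first.
  have -> : p./2%:R * 4 * u = 2 * p./2%:R * (2 * u) :> F by ring.
  by rewrite h2; ring.
case: p pcharF op p1 hp p0 h2 => // q pcharF op p1 hp _ h2.
rewrite big_ord_recl mulr0 mul0r add0r exprDn.
pose f i := 1 ^+ (q.+1./2.-1 - i) * (4 * u) ^+ i *+ 'C(q.+1./2.-1, i).
rewrite (big_ord_widen q f (ltnSE hp)).
rewrite mulr_sumr [RHS]big_mkcond; apply: eq_bigr => i _; rewrite lift0 /f.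
rewrite (bin_center_pchar pcharF op); last by rewrite ltnS.
case: ltnP => hi; last by rewrite bin_small ?(mul0r, mulr0) //; lia.
have -> : (4 * u) ^+ i = (-1) ^+ i * (-4) ^+ i * u ^+ i.
  by rewrite -!exprMn; congr (_ ^+ _); ring.
have := mul_bin_diag q.+1./2 i => /(congr1 (fun n => n%:R : F)).
rewrite /= !natrM => E.
transitivity ((i.+1%:R * 'C(q.+1./2, i.+1)%:R)
              * ((-1) ^+ i.+1 * (-4) ^+ i.+1 * u ^+ i.+1)).
  by ring.
rewrite -[in LHS]E expr1n mul1r -mulr_natl !exprS; ring.
Qed.

(* The Catalan numbers modulo [p] vanish strictly between [p./2] and [p - 1], so
   only the last two indices [j = p - 2] and [j = p - 1] contribute. *)
Lemma sum_central_catalan (F : fieldType) (p : nat) (u v : F) :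
  p \in [pchar F] -> odd p ->
  \sum_(k < p) central_sum u k * catalan_sum v k =
  2 * v ^+ p.-2 * (1 + 4 * u) ^+ p./2.-1 * (v * (1 + 4 * u) + u).
Proof.
move=> pcharF op; have p1 := prime_gt1 (pcharf_prime pcharF).
have pp : (p.-1 < p)%N by lia.
have p2 : (p.-2 < p)%N by lia.
pose a i : F := 'C(i.*2, i)%:R * u ^+ i.
have topG (i : 'I_p) : \sum_(k < p) 'C(k, i)%:R * 'C(k, p.-1)%:R = (-1) ^+ i :> F.
  rewrite -(bin_predp_pchar pcharF) // (bigD1 (Ordinal pp)) //=.
  rewrite binn mulr1 big1 ?addr0 // => k; rewrite -val_eqE /= => nk.
  by rewrite [X in _ * X%:R]bin_small ?mulr0 //; have := ltn_ord k; lia.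
(* Only k = p - 1 and k = p - 2 contribute: the sum is -'C(p-1, i) + 'C(p-2, i). *)
have subG (i : 'I_p) : \sum_(k < p) 'C(k, i)%:R * 'C(k, p.-2)%:R = (-1) ^+ i * i%:R :> F.
  rewrite (bigD1 (Ordinal pp)) //= (bigD1 (Ordinal p2)) /=; last first.
    by rewrite -val_eqE /=; lia.
  rewrite binn mulr1 [X in _ + (_ + X)]big1 ?addr0; last first.
    move=> k; rewrite -!val_eqE /= => /andP[nk nk'].
    by rewrite [X in _ * X%:R]bin_small ?mulr0 //; have := ltn_ord k; lia.
  have -> : 'C(p.-1, p.-2) = p.-1.
    by have -> : p.-1 = p.-2.+1 by [lia]; rewrite /= binSn.
  have -> : p.-1%:R = -1 :> F.
    by apply/eqP; rewrite -addr_eq0 natr1 prednK ?(pcharf0 pcharF) //; lia.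
  rewrite (bin_predp_pchar pcharF) //; have [ip|ip] := ltnP i p.-1.
    by rewrite (bin_subp2_pchar pcharF) // -natr1; ring.
  rewrite bin_small; last by lia.
  have -> : nat_of_ord i = p.-1 by have := ltn_ord i; lia.
  have -> : p.-1%:R = -1 :> F.
    by apply/eqP; rewrite -addr_eq0 natr1 prednK ?(pcharf0 pcharF) //; lia.
  by ring.
(* The coefficients 2 and -1 are the Catalan numbers of index [p] and p - 1 modulo [p]. *)
transitivity (\sum_(i < p) a i * ((-1) ^+ i * (2 * v ^+ p.-1)
                                  + (-1) ^+ i * i%:R * - v ^+ p.-2)).
  rewrite sum_binom_transform_mul; apply: eq_bigr => i _.
  rewrite (bigD1 (Ordinal pp)) //= topG.
  rewrite (bigD1 (Ordinal p2)) /=; last by rewrite -val_eqE /=; lia.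
  rewrite subG [X in _ + (_ + X)]big1 ?addr0; last first.
    move=> j; rewrite -!val_eqE /= => /andP[nj nj'].
    have [jp|jp] := leqP p./2 j.
      rewrite (catalan_pchar0 pcharF op jp) ?mul0r ?mulr0 ?mul0r //.
      by have := ltn_ord j; lia.
    have [ip|ip] := ltnP p./2 i.
      by rewrite (bin_center_pchar0 (k := i) pcharF op) ?ip ?ltn_ord // !mul0r.
    rewrite sum_bin_bin_pchar //; last by lia.
    by rewrite ifF ?mulr0 //; lia.
  have -> : (p.-2.+1 = p.-1)%N by lia.
  rewrite prednK ?(catalan_p_pchar pcharF) ?(catalan_predp_pchar pcharF) //; last lia.
  by rewrite /a; ring.
transitivity ((\sum_(i < p) (-1) ^+ i * a i) * (2 * v ^+ p.-1)
              + (\sum_(i < p) (-1) ^+ i * i%:R * a i) * - v ^+ p.-2).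
  by rewrite !mulr_suml -big_split; apply: eq_bigr => i _ /=; ring.
rewrite sum_sign_bin_center // sum_sign_mul_bin_center //.
have -> : p./2 = p./2.-1.+1 by lia.
have -> : p.-1 = p.-2.+1 by lia.
by rewrite !exprS /=; ring.
Qed.

(** Since 'C(p-1, 2k) = 1, the sum is the binomial expansion of the right-hand side. *)
Lemma trinomial_predp (F : fieldType) (p : nat) (b c : F) :
  p \in [pchar F] -> odd p -> trinomial p.-1 b c = (b ^+ 2 - 4 * c) ^+ p./2.
Proof.
move=> pcharF op; have p1 := prime_gt1 (pcharf_prime pcharF).
have hE : p.-1./2 = p./2 by lia.
rewrite /trinomial hE exprDn; apply: eq_bigr => k _; have := ltn_ord k => kh.
rewrite bin_predp_pchar //; last by lia.
rewrite -mul2n exprM sqrrN expr1n expr1n mul1r mul2n.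
rewrite (bin_center_pchar pcharF op); last by lia.
rewrite -[(- _) ^+ _ in RHS]mulr1 -mulr_natl -exprM.
have -> : (p.-1 - k.*2 = 2 * (p./2 - k))%N by lia.
have -> : (- (4 * c)) ^+ k = (-4) ^+ k * c ^+ k by rewrite -exprMn mulNr.
by ring.
Qed.

(** By [double_catalan], 2c M_(p-1) is 4c T_(p-1) minus a shifted copy of the sum for b^2 T_(p-1).
    The shift loses only the initial term [b ^+ p.+1], as the new last term vanishes modulo [p]. *)
Lemma motzkin_predp (F : fieldType) (p : nat) (b c : F) :
  p \in [pchar F] -> odd p ->
  2 * c * motzkin p.-1 b c = b ^+ p.+1 - (b ^+ 2 - 4 * c) * (b ^+ 2 - 4 * c) ^+ p./2.
Proof.
move=> pcharF op; have p1 := prime_gt1 (pcharf_prime pcharF).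
have hE : p.-1./2 = p./2 by lia.
pose d k : F := 'C(k.*2, k)%:R * b ^+ (p.+1 - k.*2) * c ^+ k.
have even_bin (k : 'I_p./2.+1) : 'C(p.-1, k.*2)%:R = 1 :> F.
  rewrite bin_predp_pchar //; last by have := ltn_ord k; lia.
  by rewrite -mul2n exprM sqrrN expr1n expr1n.
have sum_d : \sum_(k < p./2.+1) d k = b ^+ 2 * trinomial p.-1 b c.
  rewrite /trinomial hE mulr_sumr; apply: eq_bigr => k _; rewrite even_bin /d.
  have -> : (p.+1 - k.*2 = 2 + (p.-1 - k.*2))%N by have := ltn_ord k; lia.
  by rewrite exprD; ring.
have d_shift : d 0%N + \sum_(k < p./2.+1) d k.+1 = \sum_(k < p./2.+1) d k.
  rewrite -(big_ord_recl _ (fun k : 'I_p./2.+2 => d k)) big_ord_recr /=.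
  by rewrite {2}/d (bin_center_pchar0 pcharF op) ?mul0r ?addr0 //; lia.
have mE : 2 * c * motzkin p.-1 b c =
    4 * c * trinomial p.-1 b c - \sum_(k < p./2.+1) d k.+1.
  rewrite /motzkin /trinomial hE !mulr_sumr -sumrB; apply: eq_bigr => k _.
  rewrite even_bin /d.
  have -> : (p.+1 - k.+1.*2 = p.-1 - k.*2)%N by lia.
  have := congr1 (fun n => n%:R : F) (double_catalan k).
  rewrite /= natrD natrM -mul2n natrM => /(canRL (addrK _)) => cE.
  transitivity (2 * (catalan k)%:R * c * b ^+ (p.-1 - k.*2) * c ^+ k); first by ring.
  by rewrite cE exprS; ring.
have d0 : d 0%N = b ^+ p.+1 by rewrite /d bin0 double0 subn0 expr0; ring.
move: d_shift; rewrite mE sum_d d0 trinomial_predp // => /(canRL (addKr _)) ->.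
by ring.
Qed.

(** * Euler's criterion and reduction modulo p *)

Lemma rmorph_trinomial (R S : comNzRingType) (f : {rmorphism R -> S}) n b c :
  f (trinomial n b c) = trinomial n (f b) (f c).
Proof.
rewrite rmorph_sum; apply: eq_bigr => k _.
by rewrite !rmorphM !rmorphXn !rmorph_nat.
Qed.

Lemma rmorph_motzkin (R S : comNzRingType) (f : {rmorphism R -> S}) n b c :
  f (motzkin n b c) = motzkin n (f b) (f c).
Proof.
rewrite rmorph_sum; apply: eq_bigr => k _.
by rewrite !rmorphM !rmorphXn !rmorph_nat.
Qed.

Lemma trinomial_coefE n (b c : int) : trinomial_coef n b c = trinomial n b c.
Proof. by []. Qed.

Lemma motzkin_numE n (b c : int) : motzkin_num n b c = (motzkin n b c)%:~R.
Proof.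
rewrite rmorph_motzkin; apply: eq_bigr => k _; congr (_ * _ * _ * _).
by rewrite -mulS_catalan natrM mulKf // pnatr_eq0.
Qed.

Lemma exists_sqrt_extension (F : finFieldType) (c : F) :
  exists (L : fieldType) (f : {rmorphism F -> L}) (e : L), e ^+ 2 = f c.
Proof.
have size_q : size ('X^2 - c%:P) = 3%N by rewrite size_XnsubC.
have nz_q : 'X^2 - c%:P != 0 by rewrite -size_poly_eq0 size_q.
(* The list of roots is nonempty: an empty product has size 1, the polynomial has size 3. *)
have [L [[|e rs] Lq _]] := FinSplittingFieldFor nz_q.
  by have := eqp_size Lq; rewrite big_nil size_map_poly size_q size_poly1.
exists L, (in_alg L), e; apply/eqP.
have : root (map_poly (in_alg L) ('X^2 - c%:P)) e.
  by rewrite (eqp_root Lq) root_prod_XsubC mem_head.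
by rewrite rmorphB /= map_polyXn map_polyC /root !hornerE subr_eq0.
Qed.

Lemma expf_predp (p : nat) (x : 'F_p) : prime p -> x != 0 -> x ^+ p.-1 = 1.
Proof.
move=> pp x0; apply: (mulfI x0).
rewrite -exprS prednK ?prime_gt0 // mulr1.
by have := expf_card x; rewrite card_Fp.
Qed.

Lemma expf_half_double (p : nat) (x : 'F_p) :
  prime p -> odd p -> x != 0 -> x ^+ p./2 * x ^+ p./2 = 1.
Proof.
move=> pp op x0; rewrite -exprD -(expf_predp pp x0); congr (_ ^+ _).
by have := prime_gt1 pp; lia.
Qed.

(* A square root [e] of [a] in an extension satisfies [e ^+ p = e], so it lies in
   the prime field as soon as [a ^+ p./2 = 1]. *)
Lemma euler_square (p : nat) (a : 'F_p) :
  prime p -> odd p -> a ^+ p./2 = 1 -> exists x : 'F_p, x ^+ 2 = a.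
Proof.
move=> pp op a1; have [L [f [e fe]]] := exists_sqrt_extension a.
have ep : e ^+ p = e.
  rewrite -[p in LHS]odd_double_half op add1n exprS -mul2n exprM fe.
  by rewrite -rmorphXn a1 rmorph1 mulr1.
(* X^p - X is the product of all X - x with x in ['F_p]; evaluated at [e] it vanishes, so [e] is the
   image of some [x]. *)
have /(congr1 (map_poly f)) := finField_genPoly 'F_p.
rewrite card_Fp // rmorphB /= map_polyXn map_polyX rmorph_prod.
move=> /(congr1 (fun q : {poly L} => q.[e])).
rewrite !hornerE ep subrr horner_prod => /esym/eqP; rewrite prodf_seq_eq0.
case/hasP => x _ /=; rewrite rmorphB /= map_polyX map_polyC !hornerE subr_eq0.
move=> /eqP ex; exists x; apply: (fmorph_inj f).
by rewrite rmorphXn /= -ex.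
Qed.

Lemma legendre_Fp (p : nat) (a : int) :
  prime p -> odd p -> (legendre p a)%:~R = a%:~R ^+ p./2 :> 'F_p.
Proof.
move=> pp op; have pcharF := pchar_Fp pp; have p1 := prime_gt1 pp.
rewrite /legendre (dvdz_pcharf pcharF); case: eqVneq => [->|a0].
  by rewrite expr0n gtn_eqF //; lia.
have eq_mod (x : nat) : (x%:Z ^+ 2 == a %[mod p])%Z = (x%:R ^+ 2 == a%:~R :> 'F_p).
  by rewrite eqz_mod_dvd (dvdz_pcharf pcharF) rmorphB rmorphXn subr_eq0.
case: existsP => [[x]|nsq].
  rewrite eq_mod => /eqP ax; rewrite -ax -exprM.
  have x0 : x%:R != 0 :> 'F_p by apply: contraNneq a0 => x0; rewrite -ax x0 expr0n.
  by have -> : (2 * p./2 = p.-1)%N by [lia]; rewrite (expf_predp pp x0).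
(* The half power is 1 or -1, and the value 1 would provide a square root, against [nsq]. *)
have := expf_half_double pp op a0; rewrite -expr2 => /eqP.
rewrite sqrf_eq1 => /orP[/eqP a1|/eqP ->]; last by [].
have [x xa] := euler_square pp op a1; case: nsq.
exists (Ordinal (ltn_pmod x (prime_gt0 pp))).
by rewrite eq_mod /= (Fp_nat_mod pp) natr_Zp xa.
Qed.

(** Reduction modulo [p] as a relation, since it is only partial on [rat]. The fraction need not be
    in lowest terms, which makes closure under sums and products immediate. *)
Definition residue (p : nat) (x : rat) (t : 'F_p) : Prop :=
  exists a b : int,
    [/\ b%:~R != 0 :> 'F_p, x = a%:~R / b%:~R & t = a%:~R / b%:~R].

Lemma residue_int (p : nat) (a : int) : residue (a%:~R) (a%:~R : 'F_p).
Proof. by exists a, 1; rewrite !divr1 oner_eq0. Qed.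

Lemma residueV_int (p : nat) (a : int) :
  a%:~R != 0 :> 'F_p -> residue (a%:~R^-1) (a%:~R^-1 : 'F_p).
Proof. by exists 1, a; rewrite !mul1r. Qed.

Lemma intr_Fp_neq0 (p : nat) (a : int) : a%:~R != 0 :> 'F_p -> a%:~R != 0 :> rat.
Proof. by rewrite intr_eq0; apply: contra_neq => ->. Qed.

Lemma residueD (p : nat) x y (s t : 'F_p) :
  residue x s -> residue y t -> residue (x + y) (s + t).
Proof.
move=> [a [b [b0 -> ->]]] [a' [b' [b'0 -> ->]]].
exists (a * b' + a' * b), (b * b'); rewrite !(intrM, intrD).
by split; rewrite ?mulf_neq0 ?addf_div ?(intr_Fp_neq0 b0) ?(intr_Fp_neq0 b'0).
Qed.

Lemma residueM (p : nat) x y (s t : 'F_p) :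
  residue x s -> residue y t -> residue (x * y) (s * t).
Proof.
move=> [a [b [b0 -> ->]]] [a' [b' [b'0 -> ->]]].
exists (a * a'), (b * b'); rewrite !intrM.
by split; rewrite ?mulf_neq0 ?mulf_div.
Qed.

Lemma residue_sum (p n : nat) (x : nat -> rat) (t : nat -> 'F_p) :
  (forall k, residue (x k) (t k)) -> residue (\sum_(k < n) x k) (\sum_(k < n) t k).
Proof.
move=> xt; elim: n => [|n IHn]; first by rewrite !big_ord0; apply: (residue_int p 0).
by rewrite !big_ord_recr; apply: residueD.
Qed.

Lemma residue_div_exp (p n : nat) (x : rat) (t : 'F_p) (a : int) :
  a%:~R != 0 :> 'F_p -> residue x t ->
  residue (x / a%:~R ^+ n) (t / a%:~R ^+ n).
Proof.
move=> a0 xt; apply: residueM => //; rewrite -!rmorphXn /=.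
by apply: residueV_int; rewrite rmorphXn expf_neq0.
Qed.

Lemma residue_pintegral (p : nat) x (t : 'F_p) :
  prime p -> residue x t -> pintegral p x.
Proof.
move=> pp [a [b [b0 xE _]]]; rewrite /pintegral.
have : (numq x)%:~R * b%:~R = a%:~R * (denq x)%:~R :> rat.
  by rewrite numqE xE mulrAC divfK ?(intr_Fp_neq0 b0).
rewrite -!intrM => /eqP; rewrite eqr_int => /eqP E.
(* Gauss's lemma: the reduced denominator divides any other one, so it inherits being prime to
   [p]. *)
have dvd_b : (denq x %| b)%Z.
  rewrite -(@Gauss_dvdzr _ (numq x)) ?E ?dvdz_mull //.
  by rewrite coprimez_sym coprimezE coprime_num_den.
rewrite coprimezE prime_coprime //; apply: contra b0 => pd.
rewrite -(dvdz_pcharf (pchar_Fp pp)); apply: dvdz_trans dvd_b.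
by rewrite dvdzE.
Qed.

(** The bridge from identities in ['F_p] to the congruences. Cross-multiplication gives a multiple
    [w] of [p], and [w] over the product of denominators is the witness. *)
Lemma residue_congr (p : nat) x y (t : 'F_p) :
  prime p -> residue x t -> residue y t -> x ≡ y %[ratmod p].
Proof.
move=> pp xt yt; split; [exact: residue_pintegral xt | exact: residue_pintegral yt |].
case: xt yt => a [b [b0 -> ->]] [a' [b' [b'0 -> E]]].
have : (p %| a * b' - a' * b)%Z.
  rewrite (dvdz_pcharf (pchar_Fp pp)) rmorphB !rmorphM /= subr_eq0.
  by rewrite -eqr_div // E.
move=> /dvdzP[w wE]; exists (w%:~R / (b * b')%:~R).
  apply: (@residue_pintegral _ _ (w%:~R / (b * b')%:~R)) => //.
  by exists w, (b * b'); rewrite intrM mulf_neq0.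
rewrite -mulNr addf_div ?(intr_Fp_neq0 b0) ?(intr_Fp_neq0 b'0) //.
rewrite mulNr -!intrM -rmorphB wE intrM /=; ring.
Qed.

(** * The congruences *)

(** Fermat's little theorem trades inverse powers for the complementary powers of a geometric
    sum. *)
Lemma sum_div_exp_Fp (p : nat) (f : nat -> 'F_p) (m : 'F_p) :
  prime p -> m != 0 ->
  \sum_(k < p) f k / m ^+ k = \sum_(k < p) f k * m ^+ (p.-1 - k).
Proof.
move=> pp m0; apply: eq_bigr => k _; congr (_ * _).
apply: (mulIf (expf_neq0 k m0)); rewrite mulVf ?expf_neq0 // -exprD subnK.
  by rewrite expf_predp.
by have := ltn_ord k; lia.
Qed.

Lemma sum_trinomial_Fp (p : nat) (b c m : 'F_p) : prime p -> odd p -> m != 0 ->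
  \sum_(k < p) trinomial k b c / m ^+ k = ((m - b) ^+ 2 - 4 * c) ^+ p./2.
Proof.
move=> pp op m0; have pcharF := pchar_Fp pp.
rewrite (sum_div_exp_Fp (fun k => trinomial k b c)) //.
under eq_bigr do rewrite trinomial_binom.
rewrite sum_binom_transform_pchar // -trinomial_binom trinomial_predp //.
by rewrite -sqrrN opprB.
Qed.

Lemma sum_motzkin_Fp (p : nat) (b c m : 'F_p) : prime p -> odd p -> m != 0 ->
  2 * c * \sum_(k < p) motzkin k b c / m ^+ k =
  (m - b) ^+ 2 - ((m - b) ^+ 2 - 4 * c) * ((m - b) ^+ 2 - 4 * c) ^+ p./2.
Proof.
move=> pp op m0; have pcharF := pchar_Fp pp.
rewrite (sum_div_exp_Fp (fun k => motzkin k b c)) //.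
under eq_bigr do rewrite motzkin_binom.
rewrite sum_binom_transform_pchar // -motzkin_binom motzkin_predp //.
(* In ['F_p] the power [(b - m) ^+ p.+1] collapses to a square. *)
rewrite exprS -[X in _ ^+ X](card_Fp pp) expf_card -expr2.
by rewrite -[m - b]opprB sqrrN.
Qed.

Lemma sum_trinomial_sqr (F : fieldType) (p : nat) (b e e' : F) :
  p \in [pchar F] -> odd p -> e ^+ 2 = e' ^+ 2 ->
  b - 2 * e != 0 -> b - 2 * e' != 0 ->
  \sum_(k < p) trinomial k b (e ^+ 2) ^+ 2 / ((b - 2 * e) * (b - 2 * e')) ^+ k =
  (- (e / (b - 2 * e) * (e' / (b - 2 * e')))) ^+ p./2.
Proof.
move=> pcharF op ee y0 y'0; rewrite -(sum_central_central _ _ pcharF op).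
apply: eq_bigr => k _; rewrite expr2 {2}ee !trinomial_central_sum // exprMn.
by field; rewrite !expf_neq0.
Qed.

Lemma sum_trinomial_motzkin (F : fieldType) (p : nat) (b e e' : F) :
  p \in [pchar F] -> odd p -> e ^+ 2 = e' ^+ 2 ->
  b - 2 * e != 0 -> b - 2 * e' != 0 ->
  \sum_(k < p) trinomial k b (e ^+ 2) * motzkin k b (e ^+ 2)
    / ((b - 2 * e) * (b - 2 * e')) ^+ k =
  2 * (e' / (b - 2 * e')) ^+ p.-2 * (1 + 4 * (e / (b - 2 * e))) ^+ p./2.-1
    * (e' / (b - 2 * e') * (1 + 4 * (e / (b - 2 * e))) + e / (b - 2 * e)).
Proof.
move=> pcharF op ee y0 y'0; rewrite -sum_central_catalan //.
(* Only the Motzkin factor is moved to the root [e']; the trinomial one keeps [e]. *)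
apply: eq_bigr => k _; rewrite {2}ee trinomial_central_sum // motzkin_catalan_sum //.
by rewrite exprMn; field; rewrite !expf_neq0.
Qed.

(* With [e ^+ 2 = c] in an extension, the two roots [e] and [- e] give
   [(b - 2 e) (b + 2 e) = b ^+ 2 - 4 c]. *)
Lemma sum_trinomial_sqr_disc (F : finFieldType) (p : nat) (b c : F) :
  p \in [pchar F] -> odd p -> b ^+ 2 - 4 * c != 0 ->
  \sum_(k < p) trinomial k b c ^+ 2 / (b ^+ 2 - 4 * c) ^+ k =
  (c / (b ^+ 2 - 4 * c)) ^+ p./2.
Proof.
move=> pcharF op d0; have [L [f [e fe]]] := exists_sqrt_extension c.
apply: (fmorph_inj f); have pcharL : p \in [pchar L] by rewrite (fmorph_pchar f).
have dE : f (b ^+ 2 - 4 * c) = (f b - 2 * e) * (f b - 2 * - e).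
  by rewrite rmorphB rmorphXn rmorphM rmorph_nat /= -fe; ring.
have := d0; rewrite -(fmorph_eq0 f) dE mulf_eq0 negb_or => /andP[y0 y'0].
rewrite rmorph_sum rmorphXn fmorph_div dE -fe.
under eq_bigr do rewrite fmorph_div !rmorphXn /= rmorph_trinomial dE -fe.
rewrite sum_trinomial_sqr ?sqrrN //.
by congr (_ ^+ _); field; rewrite y0 y'0.
Qed.

(** With the roots [e] and [- e], 1 + 4u = (b + 2e) / (b - 2e) and v = -e / (b + 2e), so the last
    factor v (1 + 4u) + u of the general formula is 0. *)
Lemma sum_trinomial_motzkin_disc (F : finFieldType) (p : nat) (b c : F) :
  p \in [pchar F] -> odd p -> b ^+ 2 - 4 * c != 0 ->
  \sum_(k < p) trinomial k b c * motzkin k b c / (b ^+ 2 - 4 * c) ^+ k = 0.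
Proof.
move=> pcharF op d0; have [L [f [e fe]]] := exists_sqrt_extension c.
apply: (fmorph_inj f); have pcharL : p \in [pchar L] by rewrite (fmorph_pchar f).
have dE : f (b ^+ 2 - 4 * c) = (f b - 2 * e) * (f b - 2 * - e).
  by rewrite rmorphB rmorphXn rmorphM rmorph_nat /= -fe; ring.
have := d0; rewrite -(fmorph_eq0 f) dE mulf_eq0 negb_or => /andP[y0 y'0].
rewrite rmorph_sum rmorph0.
under eq_bigr do
  rewrite fmorph_div rmorphM rmorphXn /= rmorph_trinomial rmorph_motzkin dE -fe.
rewrite sum_trinomial_motzkin ?sqrrN //.
by apply/eqP; rewrite mulf_eq0; apply/orP; right; apply/eqP; field; rewrite ?y0 ?y'0.
Qed.

Theorem theorem1p1 (p : nat) (b c : int) (p_prime : prime p) (p_odd : odd p) :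
  (* (i) *)
  (forall m : int, (m != 0 %[mod p])%Z ->
    (\sum_(k < p) (trinomial_coef k b c)%:~R / m%:~R ^+ k
       ≡ (legendre p ((m - b) ^+ 2 - 4 * c))%:~R %[ratmod p])
    /\
    (2 * c%:~R * \sum_(k < p) motzkin_num k b c / m%:~R ^+ k
       ≡ ((m - b) ^+ 2 - ((m - b) ^+ 2 - 4 * c)
              * legendre p ((m - b) ^+ 2 - 4 * c))%:~R %[ratmod p]))
  /\
  (* (ii) *)
  ((let d : int := b ^+ 2 - 4 * c in
    ~~ (p %| d)%Z ->
    \sum_(k < p) (trinomial_coef k b c)%:~R ^+ 2 / d%:~R ^+ k
      ≡ (legendre p (c * d))%:~R %[ratmod p])
   /\
   ((b != 2 * c %[mod p])%Z ->
    \sum_(k < p) (trinomial_coef k b (c ^+ 2))%:~R ^+ 2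
        / (b - 2 * c)%:~R ^+ (2 * k)
      ≡ (legendre p (- c ^+ 2))%:~R %[ratmod p]))
  /\
  (* (iii) *)
  (~~ (p %| c)%Z ->
   (let d : int := b ^+ 2 - 4 * c in
    (d != 0 %[mod p])%Z ->
    \sum_(k < p) (trinomial_coef k b c)%:~R * motzkin_num k b c / d%:~R ^+ k
      ≡ 0 %[ratmod p])
   /\
   (let D : int := b ^+ 2 - 4 * c ^+ 2 in
    (D != 0 %[mod p])%Z ->
    \sum_(k < p) (trinomial_coef k b (c ^+ 2))%:~R * motzkin_num k b (c ^+ 2)
        / (b - 2 * c)%:~R ^+ (2 * k)
      ≡ (4 * b)%:~R / (b + 2 * c)%:~R * (legendre p D)%:~R %[ratmod p])).
Proof.
have pcharF := pchar_Fp p_prime; have p1 := prime_gt1 p_prime.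
have modE (x y : int) : (x == y %[mod p])%Z = (x%:~R == y%:~R :> 'F_p).
  by rewrite eqz_mod_dvd (dvdz_pcharf pcharF) rmorphB subr_eq0.
pose T k x y : 'F_p := trinomial k x%:~R y%:~R.
pose M k x y : 'F_p := motzkin k x%:~R y%:~R.
have resT k x y : residue (trinomial_coef k x y)%:~R (T k x y).
  by rewrite trinomial_coefE /T -rmorph_trinomial; apply: residue_int.
have resM k x y : residue (motzkin_num k x y) (M k x y).
  by rewrite motzkin_numE /M -rmorph_motzkin; apply: residue_int.
have res_sum (f : nat -> rat) (g : nat -> 'F_p) (a : int) :
    (a%:~R != 0 :> 'F_p) -> (forall k, residue (f k) (g k)) ->
    residue (\sum_(k < p) f k / a%:~R ^+ k) (\sum_(k < p) g k / a%:~R ^+ k).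
  move=> a0 fg; apply: (residue_sum p (x := fun k => f k / _ ^+ k)
                                      (t := fun k => g k / _ ^+ k)) => k.
  exact: residue_div_exp.
have sub2 x y (R : pzRingType) : (x - 2 * y)%:~R = x%:~R - 2 * y%:~R :> R.
  by rewrite rmorphB rmorphM.
have disc x y : (x ^+ 2 - 4 * y)%:~R = x%:~R ^+ 2 - 4 * y%:~R :> 'F_p.
  by rewrite rmorphB rmorphXn rmorphM.
have sqE : ((b - 2 * c) ^+ 2)%:~R = (b%:~R - 2 * c%:~R) * (b%:~R - 2 * c%:~R) :> 'F_p.
  by rewrite expr2 rmorphM /= sub2.
have c2E : (c ^+ 2)%:~R = c%:~R ^+ 2 :> 'F_p by rewrite rmorphXn.
split; [move=> m; rewrite modE => m0; split | split; [split|]].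
- apply: (residue_congr p_prime (res_sum _ _ _ m0 (fun k => resT k b c))).
  rewrite sum_trinomial_Fp // -rmorphB -disc -legendre_Fp //.
  exact: residue_int.
- have S := res_sum _ _ _ m0 (fun k => resM k b c).
  have := residueM (residue_int p (2 * c)) S; rewrite !rmorphM /= => S2.
  apply: (residue_congr p_prime S2).
  rewrite sum_motzkin_Fp // -rmorphB -disc -legendre_Fp // -rmorphXn -rmorphM -rmorphB.
  exact: residue_int.
- move=> d; rewrite (dvdz_pcharf pcharF) => d0.
  apply: (residue_congr p_prime
    (res_sum _ (fun k => T k b c ^+ 2) _ d0
       (fun k => residueM (resT k b c) (resT k b c)))).
  have := d0; rewrite /d disc => d0'.
  rewrite sum_trinomial_sqr_disc // expr_div_n -disc -/d.
  (* The half power of [d] is its own inverse, which turns the quotient c / d into the product c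
     d. *)
  have <- : d%:~R ^+ p./2 = (d%:~R ^+ p./2)^-1 :> 'F_p.
    apply: (mulIf (expf_neq0 p./2 d0)).
    by rewrite mulVf ?expf_neq0 // expf_half_double.
  rewrite -exprMn -rmorphM -legendre_Fp //; exact: residue_int.
- rewrite modE rmorphM /= => bc.
  have y0 : (b - 2 * c)%:~R != 0 :> 'F_p by rewrite sub2 subr_eq0.
  have y20 : ((b - 2 * c) ^+ 2)%:~R != 0 :> 'F_p by rewrite rmorphXn expf_neq0.
  under eq_bigr do rewrite exprM -[(_ %:~R) ^+ 2 in X in _ / X]rmorphXn.
  apply: (residue_congr p_prime
    (res_sum _ (fun k => T k b (c ^+ 2) ^+ 2) _ y20
       (fun k => residueM (resT k b (c ^+ 2)) (resT k b (c ^+ 2))))).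
  rewrite sqE /T c2E sum_trinomial_sqr -?sub2 //.
  rewrite -expr2 expr_div_n -[X in X ^+ p./2]mulNr expr_div_n -exprM.
  have -> : (2 * p./2 = p.-1)%N by lia.
  rewrite expf_predp -?sub2 // divr1 -rmorphXn -rmorphN -legendre_Fp //.
  exact: residue_int.
rewrite (dvdz_pcharf pcharF) => c0; split.
- move=> d; rewrite modE => d0.
  apply: (residue_congr p_prime
    (res_sum _ (fun k => T k b c * M k b c) _ d0
       (fun k => residueM (resT k b c) (resM k b c)))).
  have := d0; rewrite /d disc => d0'.
  rewrite sum_trinomial_motzkin_disc //; exact: (residue_int p 0).
move=> D; rewrite modE => D0.
have DE : D%:~R = (b - 2 * c)%:~R * (b + 2 * c)%:~R :> 'F_p.
  by rewrite -rmorphM /=; congr _%:~R; rewrite /D; ring.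
have := D0; rewrite DE mulf_eq0 negb_or => /andP[y0 z0].
have y20 : ((b - 2 * c) ^+ 2)%:~R != 0 :> 'F_p by rewrite rmorphXn expf_neq0.
under eq_bigr do rewrite exprM -[(_ %:~R) ^+ 2 in X in _ / X]rmorphXn.
apply: (residue_congr p_prime
  (res_sum _ (fun k => T k b (c ^+ 2) * M k b (c ^+ 2)) _ y20
     (fun k => residueM (resT k b (c ^+ 2)) (resM k b (c ^+ 2))))).
set lhs := \sum_(k < p) _.
(* Once this holds in ['F_p], the right-hand side visibly reduces to the same residue. *)
suff -> : lhs = (4 * b)%:~R / (b + 2 * c)%:~R * (legendre p D)%:~R.
  apply: residueM (residue_int _ _).
  exact: residueM (residue_int _ _) (residueV_int z0).
rewrite /lhs legendre_Fp // DE sqE /T /M c2E.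
rewrite sum_trinomial_motzkin -?sub2 // sub2.
rewrite sub2 in y0; rewrite rmorphD !rmorphM /= in z0 *.
set B : 'F_p := b%:~R; set C : 'F_p := c%:~R.
set u := C / (B - 2 * C); rewrite -/B -/C in y0 z0 c0.
have u1 : u ^+ p.-2 * u = 1.
  have u0 : u != 0 by rewrite mulf_neq0 ?invr_eq0.
  by rewrite -exprSr -(expf_predp p_prime u0); congr (_ ^+ _); lia.
(* Not in lowest terms on purpose: the numerator is [D], and the half power of the square below it
   is 1 by Fermat. *)
have w0 : 1 + 4 * u = (B - 2 * C) * (B + 2 * C) / (B - 2 * C) ^+ 2.
  by rewrite /u; field.
have w1 : (1 + 4 * u) ^+ p./2.-1 * (1 + 4 * u) = ((B - 2 * C) * (B + 2 * C)) ^+ p./2.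
  rewrite -exprSr prednK; last by lia.
  rewrite w0 expr_div_n -exprM.
  have -> : (2 * p./2 = p.-1)%N by lia.
  by rewrite expf_predp // divr1.
rewrite -w1.
(* The last factor u (1 + 4u) + u is u (2 + 4u); its [u] cancels against [u ^+ p.-2]. *)
transitivity (2 * (u ^+ p.-2 * u) * (1 + 4 * u) ^+ p./2.-1 * (2 + 4 * u)); first by ring.
rewrite u1 /u; field; by rewrite y0 z0.
Qed.
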